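(* Let $R$ be an iterated local skew power series ring in the ordered list of variables $x_1,\dots,x_n$ of type (A) or (B), and let $\preceq$ be a monomial order on $R$. Suppose $I$ and $J$ are left ideals of $R$ satisfying $I\subseteq J$ and $\mathrm{LM}(I)=\mathrm{LM}(J)$. Then $I=J$.
   Context: $\mathbb{N}$ contains $0$. A skew derivation on a ring $B$ is a pair $(\sigma,\delta)$ with $\sigma$ an automorphism of $B$ and $\delta:B\to B$ additive with $\delta(rs)=\delta(r)s+\sigma(r)\delta(s)$. If $(B,\mathfrak m)$ is a complete local ring, $(\sigma,\delta)$ is local if $\sigma(\mathfrak m^i)=\mathfrak m^i$ and $\delta(\mathfrak m^i)\subseteq\mathfrak m^{i+1}$ for all $i\ge 0$; then the skew power series ring $B[[x;\sigma,\delta]]$ exists: it is the left $B$-module of formal power series $\sum_j b_jx^j$ with the continuous multiplication extending $xr=\sigma(r)x+\delta(r)$ $(r\in B)$, and it is again complete local. If $A\subseteq B$ is a subring, $(\sigma,\delta)$ is $A$-linear if $\sigma(a)=a$ and $\delta(a)=0$ for all $a\in A$. The ring $R$ is one of the following. Case (A): $A=k$ is a finite field of characteristic $p$, $R_0=A$, and for $1\le i\le n$, $R_i=R_{i-1}[[x_i;\sigma_i,\delta_i]]$ with $(\sigma_i,\delta_i)$ a local, $A$-linear skew derivation on $R_{i-1}$. Put $R=R_n$. Case (B): $A$ is a (commutative) complete discrete valuation ring of characteristic $0$, not a field, with residue field $k$ a finite field of characteristic $p$; $x_1$ is a fixed uniformiser of $A$; $R_1=A$, and for $2\le i\le n$,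 $R_i=R_{i-1}[[x_i;\sigma_i,\delta_i]]$ with $(\sigma_i,\delta_i)$ a local, $A$-linear skew derivation on $R_{i-1}$. Put $R=R_n$. Let $\iota:k\to A$ be the unique multiplicative section of $A\to k$ (the identity in case (A)). For $\alpha\in\mathbb{N}^n$ write $x^\alpha=x_1^{\alpha_1}\cdots x_n^{\alpha_n}$. Every $r\in R$ is uniquely $r=\sum_{\alpha\in\mathbb{N}^n}r_\alpha x^\alpha$ with $r_\alpha\in\iota(k)$; $\mathrm{supp}(r)=\{\alpha:r_\alpha\ne0\}$. An additive total order on $\mathbb{N}^n$ is a total order with $0\prec\alpha$ for all $\alpha\neq 0$, and $\alpha\prec\beta\Rightarrow\alpha+\gamma\prec\beta+\gamma$ (it is automatically a well-order). For $r\ne0$, $\mathrm{LM}(r)=\min_\preceq\mathrm{supp}(r)$. For $S\subseteq R$, $\mathrm{LM}(S)=\{\mathrm{LM}(s):s\in S\setminus\{0\}\}\subseteq\mathbb{N}^n$. A monomial order on $R$ is an additive total order $\preceq$ with $\mathrm{LM}_\preceq(x^\alpha x^\beta)=\alpha+\beta$ for all $\alpha,\beta\in\mathbb{N}^n$. *)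

(* Defs.v *)
From HB Require Import structures.
From mathcomp Require Import all_boot all_order all_algebra.
From mathcomp Require Import boolp classical_sets.

Set Implicit Arguments.
Unset Strict Implicit.
Unset Printing Implicit Defensive.

Import GRing.Theory.
Local Open Scope classical_set_scope.
Local Open Scope ring_scope.

Definition left_ideal (R : unitRingType) (I : set R) : Prop :=
  [/\ I 0, forall a b, I a -> I b -> I (a + b) & forall r a, I a -> I (r * a)].

(* In a local ring the maximal ideal is the set of non-units. *)
Definition max_ideal (R : unitRingType) : set R :=
  [set a | a \isn't a GRing.unit].
Arguments max_ideal : clear implicits.

Definition local_ring (R : unitRingType) : Prop :=
  left_ideal (max_ideal R) /\ forall r a, max_ideal R a -> max_ideal R (a * r).

Definition ideal_mul (R : unitRingType) (I J : set R) : set R :=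
  [set r | exists m (a b : 'I_m -> R),
     [/\ forall i, I (a i), forall i, J (b i) & r = \sum_(i < m) a i * b i]].

Definition max_ideal_pow (R : unitRingType) (i : nat) : set R :=
  iter i (ideal_mul (max_ideal R)) setT.
Arguments max_ideal_pow : clear implicits.

(* R -> lim R / m^i is bijective; u is a compatible sequence of residues. *)
Definition adically_complete (R : unitRingType) : Prop :=
  forall u : nat -> R,
    (forall i, max_ideal_pow R i (u i.+1 - u i)) ->
    exists! b : R, forall i, max_ideal_pow R i (b - u i).

Record complete_dvr (A : idomainType) : Prop := CompleteDVR {
  dvr_local : local_ring A;
  dvr_principal : forall I : set A, left_ideal I ->
    exists a : A, I = [set b * a | b in setT];
  dvr_not_field : exists2 a : A, a != 0 & max_ideal A a;
  dvr_complete : adically_complete A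
}.

Definition uniformiser (A : idomainType) (t : A) : Prop :=
  max_ideal A = [set b * t | b in setT].

Definition skew_derivation (B : unitRingType)
    (sigma : {rmorphism B -> B}) (delta : {additive B -> B}) : Prop :=
  bijective sigma /\
  forall r s, delta (r * s) = delta r * s + sigma r * delta s.

Definition local_skew_derivation (B : unitRingType)
    (sigma : {rmorphism B -> B}) (delta : {additive B -> B}) : Prop :=
  skew_derivation sigma delta /\
  forall i, sigma @` max_ideal_pow B i = max_ideal_pow B i /\
            delta @` max_ideal_pow B i `<=` max_ideal_pow B i.+1.

(* f is the inclusion of A in B *)
Definition linear_skew_derivation (A B : unitRingType) (f : A -> B)
    (sigma : {rmorphism B -> B}) (delta : {additive B -> B}) : Prop :=
  forall a, sigma (f a) = f a /\ delta (f a) = 0.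

(* Basic neighbourhoods of 0 in the product topology on power series, each
   copy of B having the topology defined by the powers of its maximal ideal. *)
Definition series_nbhs (B R : unitRingType) (coef : R -> nat -> B) (N : nat) :
    set R :=
  [set r | forall j, (j < N)%N -> max_ideal_pow B N (coef r j)].

(* R = B[[x; sigma, delta]], where emb is the inclusion of B in R and coef
   identifies R with the left B-module of sequences of elements of B, the
   series \sum_j b_j x^j being identified with (b_j)_j.  Since polynomials in x
   are dense, the last two fields determine the multiplication. *)
Record skew_power_series (B : unitRingType)
    (sigma : {rmorphism B -> B}) (delta : {additive B -> B})
    (R : unitRingType) (emb : {rmorphism B -> R}) (x : R)
    (coef : R -> nat -> B) : Prop := SkewPowerSeries {
  sps_inj : forall r s, coef r =1 coef s -> r = s;
  sps_surj : forall b : nat -> B, exists r, coef r =1 b;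
  sps_add : forall r s j, coef (r + s) j = coef r j + coef s j;
  sps_scale : forall b r j, coef (emb b * r) j = b * coef r j;
  sps_var : forall i j, coef (x ^+ i) j = (j == i)%:R;
  sps_comm : forall b, x * emb b = emb (sigma b) * x + emb (delta b);
  sps_continuous : forall r s N, exists M, forall r' s',
    series_nbhs coef M (r' - r) -> series_nbhs coef M (s' - s) ->
    series_nbhs coef N (r' * s' - r * s)
}.

(* R is obtained from A by finitely many skew power series extensions by local
   A-linear skew derivations; f is the inclusion of A in R, and xs lists the
   images of the elements of s followed by the successive variables.
   Completeness and locality of the intermediate rings are not required: they
   follow from those of A. *)
Inductive iterated_sps (A : unitRingType) (s : seq A) :
    forall R : unitRingType, (A -> R) -> seq R -> Prop :=
| IteratedBase : iterated_sps s id s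
| IteratedStep (B : unitRingType) (f : A -> B) (xs : seq B)
    (sigma : {rmorphism B -> B}) (delta : {additive B -> B})
    (R : unitRingType) (emb : {rmorphism B -> R}) (x : R)
    (coef : R -> nat -> B) :
    iterated_sps s f xs ->
    local_skew_derivation sigma delta ->
    linear_skew_derivation f sigma delta ->
    skew_power_series sigma delta emb x coef ->
    iterated_sps s (emb \o f) (rcons (map emb xs) x).

(* iota is the multiplicative section k -> A followed by the inclusion of A
   in R. In type (B), k is the residue field of A through pi. *)
Variant iterated_local_sps (p : nat) (k : finFieldType) (R : unitRingType) :
    (k -> R) -> seq R -> Prop :=
| TypeA (f : k -> R) (xs : seq R) :
    p \in [pchar k] ->
    iterated_sps [::] f xs ->
    iterated_local_sps p f xs
| TypeB (A : idomainType) (pi : {rmorphism A -> k}) (tau : k -> A) (x1 : A)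
    (f : A -> R) (xs : seq R) :
    complete_dvr A -> [pchar A] =i pred0 ->
    p \in [pchar k] ->
    (forall c, exists a, pi a = c) ->
    (forall a, pi a = 0 <-> max_ideal A a) ->
    uniformiser x1 ->
    {morph tau : a b / a * b} -> cancel tau pi ->
    iterated_sps [:: x1] f xs ->
    iterated_local_sps p (f \o tau) xs.

Notation "''N^' n" := {ffun 'I_n -> nat}
  (at level 8, n at level 2, format "''N^' n") : type_scope.

Definition monomial (n : nat) (R : unitRingType) (x : n.-tuple R)
    (alpha : 'N^n) : R :=
  \prod_(i < n) tnth x i ^+ alpha i.

(* r = \sum_alpha a_alpha x^alpha, as an unordered convergent sum *)
Definition expansion (n : nat) (k : finFieldType) (R : unitRingType)
    (iota : k -> R) (x : n.-tuple R) (r : R) (a : 'N^n -> k) : Prop :=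
  forall N, exists F0 : seq 'N^n, forall F : seq 'N^n,
    uniq F -> {subset F0 <= F} ->
    max_ideal_pow R N
      (r - \sum_(alpha <- F) iota (a alpha) * monomial x alpha).

Definition coeffs (n : nat) (k : finFieldType) (R : unitRingType)
    (iota : k -> R) (x : n.-tuple R) (r : R) : 'N^n -> k :=
  xget (fun=> 0) [set a | expansion iota x r a].

Definition supp (n : nat) (k : finFieldType) (R : unitRingType)
    (iota : k -> R) (x : n.-tuple R) (r : R) : set 'N^n :=
  [set alpha | coeffs iota x r alpha != 0].

(* The value at r = 0 is irrelevant. *)
Definition LM (n : nat) (k : finFieldType) (R : unitRingType)
    (iota : k -> R) (x : n.-tuple R) (le : rel 'N^n) (r : R) : 'N^n :=
  xget 0 [set alpha | supp iota x r alpha /\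
                      forall beta, supp iota x r beta -> le alpha beta].

Definition LM_set (n : nat) (k : finFieldType) (R : unitRingType)
    (iota : k -> R) (x : n.-tuple R) (le : rel 'N^n) (S : set R) : set 'N^n :=
  [set LM iota x le s | s in [set s | S s /\ s != 0]].

Record additive_total_order (n : nat) (le : rel 'N^n) : Prop :=
  AdditiveTotalOrder {
  ato_anti : antisymmetric le;
  ato_trans : transitive le;
  ato_total : total le;
  ato_pos : forall alpha : 'N^n, alpha != 0 -> le 0 alpha;
  ato_add : forall alpha beta gamma : 'N^n, alpha != beta -> le alpha beta ->
    alpha + gamma != beta + gamma /\ le (alpha + gamma) (beta + gamma)
}.

Definition monomial_order (n : nat) (k : finFieldType) (R : unitRingType)
    (iota : k -> R) (x : n.-tuple R) (le : rel 'N^n) : Prop :=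
  additive_total_order le /\
  forall alpha beta : 'N^n,
    LM iota x le (monomial x alpha * monomial x beta) = alpha + beta.

(* Main.v *)
Require Import Defs.
From mathcomp Require Import all_boot all_order all_algebra.
From mathcomp Require Import boolp classical_sets filter zify.
Local Open Scope classical_set_scope.
Local Open Scope ring_scope.

(* R is coordinatised by functions N^n -> k, so that the powers of the maximal
   ideal become the sets of r all of whose exponents have large degree; in
   particular R is compact, as k is finite. In an iterated extension the
   coordinates of sum_j b_j x^j are those of the b_j, and the m_R-adic
   filtration is the one for which b x^j has order ord(b) + j.

   By Dickson's lemma choose g_1, ..., g_m in I whose leading monomials generate
   LM(I). Given f in J, the sets of q in R^m such that f - sum_l q_l g_l is
   supported in exponents >= gamma are closed and form a chain, so by compactness
   some q lies in all the nonempty ones. If h = f - sum_l q_l g_l were nonzero, its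
   leading monomial would lie in LM(J) = LM(I), and subtracting a multiple of some
   g_l from h would either show that f is in I or strictly increase LM(h),
   contradicting the choice of q. *)

Set Implicit Arguments.
Unset Strict Implicit.
Unset Printing Implicit Defensive.
Import GRing.Theory.

(** * Powers of the maximal ideal, and coordinates *)

Section IdealPowers.
Variable R : unitRingType.
Implicit Types (a b r : R) (I J : set R).

Lemma ideal_mul0 I J : ideal_mul I J 0.
Proof.
exists 0%N, (fun=> 0), (fun=> 0); split; try by case.
by rewrite big_ord0.
Qed.

Lemma ideal_mulD I J a b :
  ideal_mul I J a -> ideal_mul I J b -> ideal_mul I J (a + b).
Proof.
move=> [m [u [v [Iu Jv ->]]]] [m' [u' [v' [Iu' Jv' ->]]]].
pose cat_fun (h : 'I_m -> R) h' (i : 'I_(m + m')) :=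
  match fintype.split i with inl j => h j | inr j => h' j end.
exists (m + m')%N, (cat_fun u u'), (cat_fun v v'); split.
- by move=> i; rewrite /cat_fun; case: fintype.split.
- by move=> i; rewrite /cat_fun; case: fintype.split.
rewrite big_split_ord /cat_fun; congr (_ + _); apply: eq_bigr => i _.
  by rewrite (unsplitK (inl i)).
by rewrite (unsplitK (inr i)).
Qed.

Lemma ideal_mul_sum I J m (u : 'I_m -> R) :
  (forall i, ideal_mul I J (u i)) -> ideal_mul I J (\sum_i u i).
Proof.
move=> IJu; elim/big_rec: _ => [|i r _ IJr]; first exact: ideal_mul0.
exact: ideal_mulD.
Qed.

Lemma ideal_mul_in I J a b : I a -> J b -> ideal_mul I J (a * b).
Proof.
by move=> Ia Jb; exists 1%N, (fun=> a), (fun=> b); split; rewrite // big_ord1.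
Qed.

Lemma max_ideal_powSP N a : max_ideal_pow R N.+1 a ->
  exists m (u v : 'I_m -> R), [/\ forall i, max_ideal R (u i),
    forall i, max_ideal_pow R N (v i) & a = \sum_(i < m) u i * v i].
Proof. by []. Qed.

Lemma max_ideal_powS_mul N a b :
  max_ideal R a -> max_ideal_pow R N b -> max_ideal_pow R N.+1 (a * b).
Proof. exact: ideal_mul_in. Qed.

Lemma max_ideal_powD N a b :
  max_ideal_pow R N a -> max_ideal_pow R N b -> max_ideal_pow R N (a + b).
Proof. by case: N => // N; apply: ideal_mulD. Qed.

Lemma max_ideal_pow_sum N (T : Type) (l : seq T) (P : pred T) (u : T -> R) :
  (forall i, P i -> max_ideal_pow R N (u i)) ->
  max_ideal_pow R N (\sum_(i <- l | P i) u i).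
Proof.
move=> uN; elim/big_ind: _ => //; last exact: max_ideal_powD.
by case: N {uN} => // N; apply: ideal_mul0.
Qed.

Hypothesis Rlocal : local_ring R.

Lemma max_ideal_powMl N r a : max_ideal_pow R N a -> max_ideal_pow R N (r * a).
Proof.
case: N => // N /max_ideal_powSP[m [u [v [mu mv ->]]]]; rewrite mulr_sumr.
apply: ideal_mul_sum => i; rewrite mulrA.
apply: max_ideal_powS_mul (mv i); case: Rlocal => [[_ _ Ml] _]; exact: Ml.
Qed.

Lemma max_ideal_powMr N r a : max_ideal_pow R N a -> max_ideal_pow R N (a * r).
Proof.
elim: N a => // N IHN a /max_ideal_powSP[m [u [v [mu mv ->]]]]; rewrite mulr_suml.
by apply: ideal_mul_sum => i; rewrite -mulrA; apply: max_ideal_powS_mul => //; apply: IHN.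
Qed.

Lemma max_ideal_powM M N a b : max_ideal_pow R M a -> max_ideal_pow R N b ->
  max_ideal_pow R (M + N) (a * b).
Proof.
elim: M a => [|M IHM] a; first by move=> _; apply: max_ideal_powMl.
move=> /max_ideal_powSP[m [u [v [mu mv ->]]]] mb; rewrite mulr_suml.
by apply: ideal_mul_sum => i; rewrite -mulrA; apply: max_ideal_powS_mul => //; apply: IHM.
Qed.

Lemma max_ideal_pow1 a : max_ideal_pow R 1 a <-> max_ideal R a.
Proof.
split=> [[m [u [v [mu _ ->]]]]|ma]; last first.
  by rewrite -(mulr1 a); apply: max_ideal_powS_mul.
case: Rlocal => [[m0 mD _] mr]; elim/big_ind: _ => // i _; exact: mr.
Qed.

Lemma max_ideal_pow_le M N a :
  (M <= N)%N -> max_ideal_pow R N a -> max_ideal_pow R M a.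
Proof.
move=> leMN; rewrite -(subnK leMN); elim: (N - M)%N a => // d IHd a.
move=> /max_ideal_powSP[m [u [v [_ mv ->]]]].
by apply: max_ideal_pow_sum => i _; apply: max_ideal_powMl; apply: IHd.
Qed.

Lemma max_ideal_pow_var N a : max_ideal R a -> max_ideal_pow R N (a ^+ N).
Proof.
move=> ma; elim: N => // N IHN; rewrite exprS; exact: max_ideal_powS_mul.
Qed.

End IdealPowers.

(** Exponents are lists at this stage, so that adjoining a variable appends one entry instead of
    changing an index type. *)
Definition seq_mon (R : unitRingType) (xs : seq R) (a : seq nat) : R :=
  \prod_(i < size xs) xs`_i ^+ nth 0%N a i.

(** The monomial ideals of N^n, in list form. *)
Definition upclosed (n : nat) (V : set (seq nat)) : Prop :=
  forall a b, size a = n -> size b = n ->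
    (forall i, nth 0 a i <= nth 0 b i)%N -> V a -> V b.

(* In type (B) the map [cf] is not additive because of carries, but a carry
   only affects exponents above those involved; [cf_agree] says this. *)
Record coef_system (k : finFieldType) (R : unitRingType) (iota : k -> R)
    (xs : seq R) (cf : R -> seq nat -> k) : Prop := CoefSystem {
  cf_inj : forall r, (forall a, size a = size xs -> cf r a = 0) -> r = 0;
  cf_surj : forall c, exists r, forall a, size a = size xs -> cf r a = c a;
  cf_agree : forall V, upclosed (size xs) V -> forall r s,
    (forall a, size a = size xs -> ~ V a -> cf (r - s) a = 0) <->
    (forall a, size a = size xs -> ~ V a -> cf r a = cf s a);
  cf_update : forall r g c, size g = size xs -> cf r g = 0 ->
    forall a, size a = size xs ->
      cf (r + iota c * seq_mon xs g) a = if a == g then c else cf r a }.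

(** The degree filtration, to be matched with the powers of the maximal ideal. *)
Definition ord_ge (R : unitRingType) (k : finFieldType) (n : nat)
    (cf : R -> seq nat -> k) (N : nat) (r : R) : Prop :=
  forall a, size a = n -> (sumn a < N)%N -> cf r a = 0.

Lemma leq_sumn (a b : seq nat) : size a = size b ->
  (forall i, nth 0 a i <= nth 0 b i)%N -> (sumn a <= sumn b)%N.
Proof.
elim: a b => [|x a IHa] [|y b] //= [sz_ab] le_ab.
by rewrite leq_add ?(le_ab 0%N) // IHa // => i; apply: (le_ab i.+1).
Qed.

Section CoefSystem.
Variables (k : finFieldType) (R : unitRingType) (iota : k -> R) (xs : seq R).
Variable cf : R -> seq nat -> k.
Hypothesis cfP : coef_system iota xs cf.
Local Notation n := (size xs).
Implicit Types r s : R.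

Lemma cf0 a : size a = n -> cf 0 a = 0.
Proof.
move=> sz_a; rewrite -(subrr 0).
have up0 : upclosed n set0 by [].
by have [_] := cf_agree cfP up0 0 0; apply.
Qed.

Lemma cf_subr_eq0 r s : (forall a, size a = n -> cf r a = cf s a) -> r = s.
Proof.
move=> eq_cf; apply/subr0_eq/(cf_inj cfP) => a sz_a.
have up0 : upclosed n set0 by [].
by have [_] := cf_agree cfP up0 r s; apply=> // b sz_b _; apply: eq_cf.
Qed.

Lemma upclosed_deg N : upclosed n [set a | (N <= sumn a)%N].
Proof.
by move=> a b sz_a sz_b /leq_sumn le_ab /= /leq_trans -> //; apply: le_ab; rewrite sz_b.
Qed.

(** This is [cf_agree] for the up-closed set of exponents of degree at least N; it stands in for the
    additivity that [cf] may lack. *)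
Lemma ord_ge_agree N r s : ord_ge n cf N (r - s) <->
  forall a, size a = n -> (sumn a < N)%N -> cf r a = cf s a.
Proof.
have [H1 H2] := cf_agree cfP (@upclosed_deg N) r s.
split=> [rs a sz_a lt_aN|rs a sz_a lt_aN].
  by apply: H1 => // [b sz_b /= /negP|/=]; rewrite -?ltnNge => *;
    [apply: rs|apply/negP; rewrite -ltnNge].
by apply: H2 => // [b sz_b /= /negP|/=]; rewrite -?ltnNge => *;
    [apply: rs|apply/negP; rewrite -ltnNge].
Qed.

Lemma ord_geB N r s : ord_ge n cf N r -> ord_ge n cf N s -> ord_ge n cf N (r - s).
Proof. by move=> r0 s0; apply/ord_ge_agree => a sz_a ltN; rewrite r0 ?s0. Qed.

Lemma ord_ge0 N : ord_ge n cf N 0.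
Proof. by move=> a sz_a _; apply: cf0. Qed.

Lemma ord_ge_eq0 r : (forall N, ord_ge n cf N r) -> r = 0.
Proof. by move=> r0; apply: (cf_inj cfP) => a sz_a; apply: (r0 (sumn a).+1). Qed.

Lemma ord_ge_complete (u : nat -> R) :
  (forall i, ord_ge n cf i (u i.+1 - u i)) ->
  exists r, forall i, ord_ge n cf i (r - u i).
Proof.
move=> u_cauchy.
(* The coordinate at a no longer changes from index [(sumn a).+1] on, so the limit can be read off
   there. *)
have [r cf_r] := cf_surj cfP (fun a => cf (u (sumn a).+1) a).
exists r => i; apply/ord_ge_agree => a sz_a lt_ai; rewrite cf_r //.
rewrite -(subnK lt_ai); elim: (i - _)%N => // d ->.
rewrite addSn; apply/esym; move: a sz_a {lt_ai} => a sz_a.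
have /ord_ge_agree := u_cauchy (d + (sumn a).+1)%N.
by apply=> //; rewrite addnS ltnS leq_addl.
Qed.

End CoefSystem.

(** * Skew power series over a coordinatised ring *)

Section SkewPowerSeriesStep.
Variables (B : unitRingType) (sigma : {rmorphism B -> B}).
Variables (delta : {additive B -> B}) (R : unitRingType).
Variables (emb : {rmorphism B -> R}) (x : R) (coef : R -> nat -> B).
Variables (k : finFieldType) (iota : k -> B) (xs : seq B).
Variable cf : B -> seq nat -> k.
Hypothesis cfP : coef_system iota xs cf.
Hypothesis Blocal : local_ring B.
Local Notation n := (size xs).
Hypothesis powB : forall N b, max_ideal_pow B N b <-> ord_ge n cf N b.
Hypothesis skewP : local_skew_derivation sigma delta.
Hypothesis spsP : skew_power_series sigma delta emb x coef.
Implicit Types (r s t : R) (b c : B).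

Let powB_eq0 b : (forall N, max_ideal_pow B N b) -> b = 0.
Proof. by move=> b0; apply: (ord_ge_eq0 cfP) => N; apply/powB. Qed.

Let powB0 N : max_ideal_pow B N 0.
Proof. by apply/powB/(ord_ge0 cfP). Qed.

Let powBB N b c : max_ideal_pow B N b -> max_ideal_pow B N c ->
  max_ideal_pow B N (b - c).
Proof. by move=> /powB b0 /powB c0; apply/powB/(ord_geB cfP). Qed.

Lemma coefD r s j : coef (r + s) j = coef r j + coef s j.
Proof. exact: (sps_add spsP). Qed.

Lemma coef0 j : coef 0 j = 0.
Proof. by apply: (addrI (coef 0 j)); rewrite -coefD !addr0. Qed.

Lemma coefN r j : coef (- r) j = - coef r j.
Proof. by apply: (addrI (coef r j)); rewrite -coefD !subrr coef0. Qed.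

Lemma coefB r s j : coef (r - s) j = coef r j - coef s j.
Proof. by rewrite coefD coefN. Qed.

Lemma coef_sum (T : Type) (l : seq T) (P : pred T) (u : T -> R) j :
  coef (\sum_(i <- l | P i) u i) j = \sum_(i <- l | P i) coef (u i) j.
Proof. exact: (big_morph _ (fun r s => coefD r s j) (coef0 j)). Qed.

Lemma coef_mon b i j : coef (emb b * x ^+ i) j = if j == i then b else 0.
Proof.
by rewrite (sps_scale spsP) (sps_var spsP); case: eqP; rewrite ?mulr1 ?mulr0.
Qed.

Definition sps_trunc M r : R := \sum_(j < M) emb (coef r j) * x ^+ j.

Lemma coef_trunc M r j : coef (sps_trunc M r) j = if (j < M)%N then coef r j else 0.
Proof.
rewrite coef_sum; under eq_bigr do rewrite coef_mon.
case: ltnP => [ltjM|leMj].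
  rewrite (bigD1 (Ordinal ltjM)) //= eqxx big1 ?addr0 // => i ne_ij.
  by case: eqP => // eq_ji; case/eqP: ne_ij; apply: val_inj.
rewrite big1 // => i _; case: eqP => // eq_ji.
by have := ltn_ord i; rewrite -eq_ji ltnNge leMj.
Qed.

(** Subtraction is truncated, so the coefficients of x^j with j >= N are unrestricted. *)
Definition sps_filt N : set R :=
  [set r | forall j, max_ideal_pow B (N - j) (coef r j)].

Lemma sps_filtB N r s : sps_filt N r -> sps_filt N s -> sps_filt N (r - s).
Proof. by move=> r0 s0 j; rewrite coefB; apply: powBB. Qed.

Lemma sps_filt0 N : sps_filt N 0.
Proof. by move=> j; rewrite coef0; apply: powB0. Qed.

Lemma sps_filtN N r : sps_filt N (- r) <-> sps_filt N r.
Proof.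
have oppF s : sps_filt N s -> sps_filt N (- s).
  by move=> s0; rewrite -sub0r; apply: sps_filtB => //; apply: sps_filt0.
by split=> /oppF; rewrite ?opprK.
Qed.

Lemma sps_filtD N r s : sps_filt N r -> sps_filt N s -> sps_filt N (r + s).
Proof.
by move=> r0 /sps_filtN s0; rewrite -(opprK s); apply: sps_filtB.
Qed.

Lemma sps_filt_sum N (T : Type) (l : seq T) (P : pred T) (u : T -> R) :
  (forall i, P i -> sps_filt N (u i)) -> sps_filt N (\sum_(i <- l | P i) u i).
Proof.
by move=> u0; elim/big_ind: _ => //; [apply: sps_filt0|apply: sps_filtD].
Qed.

Lemma sps_filt_le M N r : (M <= N)%N -> sps_filt N r -> sps_filt M r.
Proof.
move=> leMN r0 j; apply: (max_ideal_pow_le Blocal) (r0 j).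
exact: leq_sub2r.
Qed.

Lemma sps_filt_eq0 r : (forall N, sps_filt N r) -> r = 0.
Proof.
move=> r0; apply: (sps_inj spsP) => j; rewrite coef0; apply: powB_eq0 => N.
by have := r0 (N + j)%N j; rewrite addnK.
Qed.

(** Through this inclusion the continuity of the product, given for the product topology, yields
    estimates in the filtration. *)
Lemma sps_nbhs_filt N r : series_nbhs coef N r -> sps_filt N r.
Proof.
move=> r0 j; case: (ltnP j N) => [/r0|leNj].
  by apply: (max_ideal_pow_le Blocal); rewrite leq_subr.
by move: leNj; rewrite -subn_eq0 => /eqP->.
Qed.

Lemma sps_trunc_nbhs M r : series_nbhs coef M (sps_trunc M r - r).
Proof.
by move=> j ltjM; rewrite coefB coef_trunc ltjM subrr; apply: powB0.
Qed.

(** Continuity at (r, s) reduces filtration estimates for products to polynomials in x. *)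
Lemma sps_trunc_mul N r s :
  exists M, sps_filt N (sps_trunc M r * sps_trunc M s - r * s).
Proof.
have [M contM] := sps_continuous spsP r s N; exists M.
by apply: sps_nbhs_filt; apply: contM; apply: sps_trunc_nbhs.
Qed.

Lemma sps_filt_scale M N b r : max_ideal_pow B M b -> sps_filt N r ->
  sps_filt (M + N) (emb b * r).
Proof.
move=> mb r0 j; rewrite (sps_scale spsP).
apply: (max_ideal_pow_le Blocal) (max_ideal_powM Blocal mb (r0 j)).
by rewrite leq_subLR addnCA leq_add2l -leq_subLR.
Qed.

Lemma sps_filt_mon M b i : max_ideal_pow B M b -> sps_filt (M + i) (emb b * x ^+ i).
Proof.
move=> mb j; rewrite coef_mon; case: eqP => [->|_]; last exact: powB0.
by rewrite addnK.
Qed.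

(** Moving one x past b gives two terms of the same total order: sigma keeps the order of b and the
    x, while delta loses the x but raises the order of b by one. *)
Lemma sps_filt_var_mon M b i j : max_ideal_pow B M b ->
  sps_filt (M + i + j) (x ^+ i * (emb b * x ^+ j)).
Proof.
elim: i M b j => [|i IHi] M b j mb.
  by rewrite mul1r addn0; apply: sps_filt_mon.
rewrite exprSr -mulrA [x * _]mulrA (sps_comm spsP) mulrDl mulrDr -mulrA -exprS.
have [_ /(_ M)[sigM deltaM]] := skewP.
apply: sps_filtD.
  rewrite addnS addSnnS; apply: IHi; rewrite -sigM; by exists b.
rewrite addnS -addSn; apply: IHi; apply: deltaM; by exists b.
Qed.

Lemma sps_filtM M N r s : sps_filt M r -> sps_filt N s -> sps_filt (M + N) (r * s).
Proof.
move=> r0 s0; have [L truncL] := sps_trunc_mul (M + N) r s.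
suff trunc0 : sps_filt (M + N) (sps_trunc L r * sps_trunc L s).
  by rewrite -[r * s](subKr (sps_trunc L r * sps_trunc L s)); apply: sps_filtB.
rewrite mulr_suml; apply: sps_filt_sum => i _; rewrite mulr_sumr.
apply: sps_filt_sum => j _; rewrite -mulrA.
(* The coefficients of x^i in r and of x^j in s have orders at least M - i and N - j; truncation of
   these differences can only increase the sum. *)
apply: (@sps_filt_le _ ((M - i) + ((N - j) + i + j))); first by lia.
by apply: sps_filt_scale; [apply: r0|apply: sps_filt_var_mon; apply: s0].
Qed.

Lemma sps_filt_all r : sps_filt 0 r.
Proof. by move=> j; rewrite sub0n. Qed.

Lemma sps_filtMl N r s : sps_filt N s -> sps_filt N (r * s).
Proof. by move=> s0; have := sps_filtM (sps_filt_all r) s0. Qed.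

Lemma sps_filtMr N r s : sps_filt N r -> sps_filt N (r * s).
Proof. by move=> r0; rewrite -(addn0 N); apply: sps_filtM => //; apply: sps_filt_all. Qed.

Lemma sps_filt_var : sps_filt 1 x.
Proof.
have := @sps_filt_mon 0 1 1; rewrite rmorph1 mul1r expr1; exact.
Qed.

Lemma sps_trunc_filt M r : sps_filt M (r - sps_trunc M r).
Proof. by apply/sps_filtN; rewrite opprB; apply/sps_nbhs_filt/sps_trunc_nbhs. Qed.

(** Division by x on the right. For polynomials it is a reindexing of the sum; the general case
    follows since the truncation of r at M + 1 is the constant term plus x times the truncation of t
    at M, with x on the right. *)
Lemma sps_shift r t : (forall j, coef t j = coef r j.+1) ->
  r = emb (coef r 0) + t * x.
Proof.
move=> tE; apply/subr0_eq/sps_filt_eq0 => M.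
suff -> : r - (emb (coef r 0) + t * x) =
    (r - sps_trunc M.+1 r) - (t - sps_trunc M t) * x.
  apply: sps_filtB; first by apply: sps_filt_le (sps_trunc_filt _ _).
  exact/sps_filtMr/sps_trunc_filt.
have -> : sps_trunc M.+1 r = emb (coef r 0) + sps_trunc M t * x.
  rewrite /sps_trunc big_ord_recl mulr1 mulr_suml; congr (_ + _).
  by apply: eq_bigr => i _; rewrite tE -mulrA -exprSr.
by rewrite mulrBl opprB !opprD -!addrA addKr.
Qed.

(** By A-linearity x commutes with the image of A, hence so do polynomials in x, and then all series
    by approximation. *)
Lemma sps_central (A : unitRingType) (f : A -> B) :
  (forall a b, f a * b = b * f a) -> linear_skew_derivation f sigma delta ->
  forall a r, emb (f a) * r = r * emb (f a).
Proof.
move=> fC f_lin a r; have [sig_a del_a] := f_lin a.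
have xC : x * emb (f a) = emb (f a) * x.
  by rewrite (sps_comm spsP) sig_a del_a rmorph0 addr0.
have truncC M : emb (f a) * sps_trunc M r = sps_trunc M r * emb (f a).
  rewrite mulr_sumr mulr_suml; apply: eq_bigr => i _.
  rewrite mulrA -rmorphM fC rmorphM -!mulrA; congr (_ * _).
  exact/commrX/esym.
apply/subr0_eq/sps_filt_eq0 => M.
have -> : emb (f a) * r - r * emb (f a) =
    emb (f a) * (r - sps_trunc M r) - (r - sps_trunc M r) * emb (f a).
  by rewrite mulrBr mulrBl truncC opprB addrA subrK.
by apply: sps_filtB; [apply: sps_filtMl|apply: sps_filtMr]; apply: sps_trunc_filt.
Qed.

Local Notation ys := (rcons (map emb xs) x).

Definition sps_cf r (a : seq nat) : k := cf (coef r (nth 0%N a n)) (take n a).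

Lemma size_sps_vars : size ys = n.+1.
Proof. by rewrite size_rcons size_map. Qed.

Lemma rcons_takeK (a : seq nat) : size a = n.+1 -> a = rcons (take n a) (nth 0%N a n).
Proof. by move=> sz_a; rewrite -take_nth ?sz_a // -sz_a take_size. Qed.

Lemma size_takeS (a : seq nat) : size a = n.+1 -> size (take n a) = n.
Proof. by move=> sz_a; rewrite size_take sz_a ltnSn. Qed.

Lemma sps_cf_rcons r a j : size a = n -> sps_cf r (rcons a j) = cf (coef r j) a.
Proof.
by move=> sz_a; rewrite /sps_cf nth_rcons sz_a ltnn eqxx -cats1 -sz_a take_size_cat.
Qed.

Lemma seq_mon_rcons a j : size a = n ->
  seq_mon ys (rcons a j) = emb (seq_mon xs a) * x ^+ j.
Proof.
move=> sz_a; rewrite /seq_mon size_sps_vars big_ord_recr /=.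
rewrite !nth_rcons size_map sz_a ltnn eqxx rmorph_prod; congr (_ * _).
apply: eq_bigr => i _.
by rewrite !nth_rcons size_map sz_a ltn_ord rmorphXn (nth_map 0).
Qed.

Lemma upclosed_rcons V j : upclosed n.+1 V -> upclosed n [set a | V (rcons a j)].
Proof.
move=> upV a b sz_a sz_b le_ab /=; apply: upV; rewrite ?size_rcons ?sz_a ?sz_b //.
move=> i; rewrite !nth_rcons sz_a sz_b; case: ltnP => // _; exact: leqnn.
Qed.

(** All four properties are checked one power of x at a time: [coef] is additive, so no carry passes
    between powers of x, and the slices of an up-closed set are up-closed. *)
Lemma sps_coef_system : coef_system (emb \o iota) ys sps_cf.
Proof.
split; rewrite size_sps_vars.
- move=> r r0; apply: (sps_inj spsP) => j; rewrite coef0.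
  apply: (cf_inj cfP) => a sz_a; rewrite -sps_cf_rcons //; apply: r0.
  by rewrite size_rcons sz_a.
- move=> c.
  have [b bP] := choice (fun j => cf_surj cfP (fun a => c (rcons a j))).
  have [r rP] := sps_surj spsP b; exists r => a sz_a.
  by rewrite /sps_cf rP bP ?size_takeS // -rcons_takeK.
- move=> V upV r s; split=> rs a sz_a; rewrite [a]rcons_takeK //;
    set j := nth _ a n; set a' := take n a => Va.
    rewrite !sps_cf_rcons ?size_takeS //.
    have [H _] := cf_agree cfP (upclosed_rcons (j := j) upV) (coef r j) (coef s j).
    apply: H => //; last exact: size_takeS.
    move=> b sz_b Vb; rewrite -coefB -sps_cf_rcons //; apply: rs => //.
    by rewrite size_rcons sz_b.
  rewrite sps_cf_rcons ?size_takeS // coefB.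
  have [_ H] := cf_agree cfP (upclosed_rcons (j := j) upV) (coef r j) (coef s j).
  apply: H => //; last exact: size_takeS.
  move=> b sz_b Vb; rewrite -!sps_cf_rcons //; apply: rs => //.
  by rewrite size_rcons sz_b.
move=> r g c sz_g; rewrite (rcons_takeK sz_g).
set j := nth _ g n; set g' := take n g.
have sz_g' : size g' = n by apply: size_takeS.
rewrite sps_cf_rcons // => r0 a sz_a.
rewrite (rcons_takeK sz_a) eqseq_rcons.
set i := nth _ a n; set a' := take n a.
have sz_a' : size a' = n by apply: size_takeS.
rewrite !sps_cf_rcons // seq_mon_rcons //= mulrA -rmorphM coefD coef_mon.
case: eqP => [->|_]; last by rewrite andbF addr0.
by rewrite andbT (cf_update cfP).
Qed.

Lemma sps_filt_ord N r : sps_filt N r <-> ord_ge n.+1 sps_cf N r.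
Proof.
split=> [r0 a sz_a|r0 j].
  rewrite (rcons_takeK sz_a) sumn_rcons sps_cf_rcons ?size_takeS // => ltN.
  by have /powB := r0 (nth 0%N a n); apply; rewrite ?size_takeS //; lia.
apply/powB => a sz_a lt_a; rewrite -sps_cf_rcons //; apply: r0.
  by rewrite size_rcons sz_a.
by rewrite sumn_rcons; lia.
Qed.

(** The inverse is the limit of the geometric sums [u i]. These commute with 1 - t, so the limit is
    an inverse on both sides. *)
Lemma sps_unit_1B t : sps_filt 1 t -> (1 - t) \is a GRing.unit.
Proof.
move=> t1; pose u i := \sum_(j < i) t ^+ j.
have tX i : sps_filt i (t ^+ i).
  elim: i => [|i IHi]; first exact: sps_filt_all.
  by rewrite exprS -add1n; apply: sps_filtM.
have [s sP] : exists s, forall i, sps_filt i (s - u i).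
  have [|s sP] := @ord_ge_complete _ _ _ _ _ sps_coef_system u.
    move=> i; rewrite size_sps_vars; apply/sps_filt_ord.
    suff -> : u i.+1 - u i = t ^+ i by [].
    by rewrite /u big_ord_recr /= addrAC subrr add0r.
  by exists s => i; apply/sps_filt_ord; rewrite -size_sps_vars.
have tC i : (1 - t) * u i = u i * (1 - t).
  rewrite /u mulr_sumr mulr_suml; apply: eq_bigr => j _.
  by apply/esym/commrB; [apply: commr1|apply/commr_sym/commrX].
have tu i : (1 - t) * u i = 1 - t ^+ i by rewrite -(opprB t) mulNr -subrX1 opprB.
apply/unitrP; exists s; split; apply/subr0_eq/sps_filt_eq0 => i.
  have -> : s * (1 - t) - 1 = (s - u i) * (1 - t) - t ^+ i.
    by rewrite [in RHS]mulrBl -tC tu opprB addrA [RHS]addrAC addrK.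
  by apply: sps_filtB => //; apply: sps_filtMr.
have -> : (1 - t) * s - 1 = (1 - t) * (s - u i) - t ^+ i.
  by rewrite [in RHS]mulrBr tu opprB addrA [RHS]addrAC addrK.
by apply: sps_filtB => //; apply: sps_filtMl.
Qed.

(** Order at least 1 only constrains the constant coefficient. If that coefficient is a unit,
    dividing by it leaves 1 - t with t of order at least 1. Conversely, a unit of order at least 1
    would put 1 in the maximal ideal of B. *)
Lemma sps_max_ideal r : max_ideal R r <-> sps_filt 1 r.
Proof.
have [[_ _ mMl] _] := Blocal.
split=> [r_nu j|r1].
  case: j => [|j]; last by rewrite subSS sub0n.
  apply/max_ideal_pow1 => //; apply/negP => r0_unit; case/negP: r_nu.
  pose b := (coef r 0)^-1.
  have emb_unit : emb b \is a GRing.unit by apply: rmorph_unit; rewrite unitrV.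
  rewrite -(unitrMr _ emb_unit) -[_ * r](subKr 1); apply: sps_unit_1B => j.
  rewrite coefB (sps_scale spsP) -(expr0 x) (sps_var spsP).
  case: j => [|j]; last by rewrite subSS sub0n.
  by rewrite mulVr // subrr; apply: powB0.
apply/negP => r_unit; have := sps_filtMr r^-1 r1; rewrite mulrV // => /(_ 0%N).
rewrite -(expr0 x) (sps_var spsP) /= => /(max_ideal_pow1 Blocal).
by rewrite /max_ideal /= unitr1.
Qed.

Lemma sps_local : local_ring R.
Proof.
split; first split.
- by apply/sps_max_ideal/sps_filt0.
- by move=> r s /sps_max_ideal r1 /sps_max_ideal s1; apply/sps_max_ideal/sps_filtD.
- by move=> r s /sps_max_ideal s1; apply/sps_max_ideal/sps_filtMl.
by move=> r s /sps_max_ideal s1; apply/sps_max_ideal/sps_filtMr.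
Qed.

Lemma emb_max_ideal_pow N b : max_ideal_pow B N b -> max_ideal_pow R N (emb b).
Proof.
elim: N b => // N IHN b /max_ideal_powSP[m [u [v [mu mv ->]]]].
rewrite rmorph_sum; apply: ideal_mul_sum => i; rewrite rmorphM.
apply: max_ideal_powS_mul; last exact: IHN.
apply/sps_max_ideal; rewrite -(mulr1 (emb _)) -(expr0 x) -(addn0 1%N).
by apply: sps_filt_mon; apply/max_ideal_pow1.
Qed.

Lemma sps_max_ideal_pow N r : max_ideal_pow R N r <-> ord_ge n.+1 sps_cf N r.
Proof.
rewrite -sps_filt_ord; split.
  elim: N r => [|N IHN] r; first by move=> _; apply: sps_filt_all.
  move=> /max_ideal_powSP[m [u [v [mu mv ->]]]].
  apply: sps_filt_sum => i _; rewrite -add1n; apply: sps_filtM; last exact: IHN.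
  exact/sps_max_ideal.
elim: N r => // N IHN r r0.
(* Here r is its constant term plus t * x, where t has order at least N and x lies in the maximal
   ideal, so the induction hypothesis applies to t. *)
have [t tE] := sps_surj spsP (fun j => coef r j.+1).
rewrite (sps_shift tE); apply: max_ideal_powD.
  exact/emb_max_ideal_pow/(r0 0%N).
rewrite -addn1; apply: (max_ideal_powM sps_local).
  by apply: IHN => j; rewrite tE; apply: (r0 j.+1).
by apply/(max_ideal_pow1 sps_local)/sps_max_ideal/sps_filt_var.
Qed.

End SkewPowerSeriesStep.

(** * Base rings of the iterated extension *)

(** The invariant carried through the iteration: coordinates in which the m-adic filtration is the
    filtration by degree. *)
Definition good_coefs (k : finFieldType) (R : unitRingType) (iota : k -> R)
    (xs : seq R) (cf : R -> seq nat -> k) : Prop :=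
  coef_system iota xs cf /\
  forall N r, max_ideal_pow R N r <-> ord_ge (size xs) cf N r.

Lemma iterated_sps_good (k : finFieldType) (A R : unitRingType) (tau : k -> A)
    (s : seq A) (f : A -> R) (xs : seq R) :
  local_ring A -> (forall a b : A, a * b = b * a) ->
  (exists cf, good_coefs tau s cf) -> iterated_sps s f xs ->
  [/\ local_ring R, forall a r, f a * r = r * f a &
      exists cf, good_coefs (f \o tau) xs cf].
Proof.
move=> Aloc AC Agood; elim=> {R f xs} // B f xs sigma delta R emb x coef _.
move=> [Bloc fC [cf [cfP powB]]] skewP linP spsP; split.
- exact: (sps_local cfP Bloc powB skewP spsP).
- exact: (sps_central cfP Bloc powB skewP spsP).
exists (sps_cf coef xs cf); split; first exact: (sps_coef_system cfP spsP).
move=> N r; rewrite size_sps_vars.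
exact: (sps_max_ideal_pow cfP Bloc powB skewP spsP).
Qed.

Lemma iterated_sps_rmorph (A R : unitRingType) (s : seq A) (f : A -> R)
    (xs : seq R) : iterated_sps s f xs -> exists g : {rmorphism A -> R}, f = g.
Proof.
elim=> {R f xs} [|B f xs sigma delta R emb x coef _ [g ->] _ _ _].
  by exists idfun.
by exists (emb \o g).
Qed.

(** * Type (A): the base field *)

Section FieldBase.
Variable k : finFieldType.

Lemma field_max_ideal (a : k) : max_ideal k a <-> a = 0.
Proof.
rewrite /max_ideal /= unitfE negbK; split=> [/eqP//|->]; exact: eqxx.
Qed.

Lemma field_local : local_ring k.
Proof.
split; first split; first exact/field_max_ideal.
- by move=> a b /field_max_ideal-> /field_max_ideal->; apply/field_max_ideal; rewrite addr0.
- by move=> r a /field_max_ideal->; apply/field_max_ideal; rewrite mulr0.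
by move=> r a /field_max_ideal->; apply/field_max_ideal; rewrite mul0r.
Qed.

Lemma field_good : good_coefs (id : k -> k) [::] (fun r _ => r).
Proof.
split; first split.
- by move=> r /(_ [::] erefl).
- by move=> c; exists (c [::]) => a /size0nil->.
- move=> V _ r s; split=> rs a sz_a Va; first exact/subr0_eq/(rs a).
  by rewrite (rs a) // subrr.
- move=> r g c /size0nil-> -> a /size0nil->.
  by rewrite /seq_mon big_ord0 mulr1 add0r.
(* Without variables the only exponent is the empty list, of degree 0: N = 0 imposes nothing, and
   any larger N says r = 0. *)
case=> [|N] r; first by split=> // _ a.
split=> [rN a sz_a _|/(_ [::] erefl) ->//]; last exact: ideal_mul0.
apply/field_max_ideal/(max_ideal_pow1 field_local).
exact: max_ideal_pow_le field_local _ _ _ _ rN.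
Qed.

End FieldBase.

(** * Type (B): digit expansions in a complete discrete valuation ring *)

Section DVRBase.
Variables (k : finFieldType) (A : idomainType) (pi : {rmorphism A -> k}).
Variables (tau : k -> A) (t : A).
Hypothesis Advr : complete_dvr A.
Hypothesis pi_ker : forall a, pi a = 0 <-> max_ideal A a.
Hypothesis t_unif : uniformiser t.
Hypothesis tauM : {morph tau : a b / a * b}.
Hypothesis tauK : cancel tau pi.

Lemma max_idealP a : max_ideal A a <-> exists b, a = b * t.
Proof.
by rewrite t_unif; split=> [[b _ <-]|[b ->]]; exists b.
Qed.

Lemma unif_neq0 : t != 0.
Proof.
apply/eqP => t0; have [a a0 /max_idealP[b ab]] := dvr_not_field Advr.
by case/eqP: a0; rewrite ab t0 mulr0.
Qed.

Lemma unif_max : max_ideal A t.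
Proof. by apply/max_idealP; exists 1; rewrite mul1r. Qed.

(** By multiplicativity [tau 0] is an idempotent of a domain, and it is not 1 because pi sends it to
    0. *)
Lemma section0 : tau 0 = 0.
Proof.
have : tau 0 * (tau 0 - 1) = 0 by rewrite mulrBr -tauM mulr0 mulr1 subrr.
move/eqP; rewrite mulf_eq0 subr_eq0 => /orP[/eqP//|/eqP tau01].
by have := tauK 0; rewrite tau01 rmorph1 => /eqP; rewrite oner_eq0.
Qed.

Lemma residue_var b : pi (b * t) = 0.
Proof. by apply/pi_ker/max_idealP; exists b. Qed.

Lemma dvr_max_ideal_pow N r : max_ideal_pow A N r <-> exists b, r = b * t ^+ N.
Proof.
have Aloc := dvr_local Advr.
split=> [|[b ->]]; last first.
  by apply: max_ideal_powMl => //; apply: max_ideal_pow_var unif_max.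
elim: N r => [|N IHN] r; first by exists r; rewrite mulr1.
move=> /max_ideal_powSP[m [u [v [mu mv ->]]]].
elim/big_ind: _ => [|_ _ [b ->] [c ->]|i _].
- by exists 0; rewrite mul0r.
- by exists (b + c); rewrite mulrDl.
have [b ->] := (max_idealP _).1 (mu i); have [c ->] := IHN _ (mv i).
by exists (b * c); rewrite exprS mulrACA.
Qed.

Lemma digit_rest_ex r : exists q, r = tau (pi r) + q * t.
Proof.
have /pi_ker/max_idealP[q rq] : pi (r - tau (pi r)) = 0.
  by rewrite rmorphB /= tauK subrr.
by exists q; rewrite -rq addrC subrK.
Qed.

Definition digit_rest : A -> A := projT1 (choice digit_rest_ex).

Lemma digit_restE r : r = tau (pi r) + digit_rest r * t.
Proof. exact: (projT2 (choice digit_rest_ex)). Qed.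

Lemma residueDM c q : pi (tau c + q * t) = c.
Proof. by rewrite rmorphD /= residue_var tauK addr0. Qed.

Lemma digit_restDM c q : digit_rest (tau c + q * t) = q.
Proof.
have := digit_restE (tau c + q * t); rewrite residueDM => /addrI.
by move=> /(mulIf unif_neq0).
Qed.

(** The Teichmüller digits: r is the sum of the [tau (digit r j) * t ^+ j]. *)
Definition digit r j : k := pi (iter j digit_rest r).

Lemma digitS r j : digit r j.+1 = digit (digit_rest r) j.
Proof. by rewrite /digit iterSr. Qed.

(** Induction on N: congruence modulo t forces equal first digits, whose lifts cancel in r - s, and
    then a factor t can be divided out. *)
Lemma digit_agree N r s : max_ideal_pow A N (r - s) <->
  forall j, (j < N)%N -> digit r j = digit s j.
Proof.
elim: N r s => [|N IHN] r s.
  by split=> // _; apply/dvr_max_ideal_pow; exists (r - s); rewrite mulr1.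
have rsE : r - s =
    (tau (pi r) - tau (pi s)) + (digit_rest r - digit_rest s) * t.
  rewrite {1}[r]digit_restE {1}[s]digit_restE mulrBl opprD.
  by rewrite addrACA.
split=> [/dvr_max_ideal_pow[b rsb]|rs_eq].
  have pi_rs : pi r = pi s.
    by apply/subr0_eq; rewrite -rmorphB rsb exprSr mulrA residue_var.
  case=> [_|j ltjN]; first exact: pi_rs.
  rewrite !digitS; apply: (IHN _ _).1 ltjN; apply/dvr_max_ideal_pow; exists b.
  apply: (mulIf unif_neq0); rewrite -mulrA -exprSr -rsb rsE pi_rs subrr.
  by rewrite add0r.
have /dvr_max_ideal_pow[b rsb] : max_ideal_pow A N (digit_rest r - digit_rest s).
  by apply/IHN => j ltjN; rewrite -!digitS rs_eq.
apply/dvr_max_ideal_pow; exists b; rewrite rsE rsb [pi r](rs_eq 0%N) //.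
by rewrite subrr add0r exprSr mulrA.
Qed.

Lemma digit0 j : digit 0 j = 0.
Proof.
elim: j => [|j IHj]; first exact: rmorph0.
rewrite digitS; suff -> : digit_rest 0 = 0 by [].
by have := digit_restDM 0 0; rewrite section0 mul0r addr0.
Qed.

(** Both r and 0 are limits of the constant sequence 0, and limits are unique by completeness. *)
Lemma digit_eq0 r : (forall j, digit r j = 0) -> r = 0.
Proof.
move=> r0; have r_pow N : max_ideal_pow A N r.
  by rewrite -(subr0 r); apply/digit_agree => j _; rewrite r0 digit0.
have zero_pow N : max_ideal_pow A N 0.
  by apply/dvr_max_ideal_pow; exists 0; rewrite mul0r.
have [|b [_ b_uniq]] := dvr_complete Advr (u := fun=> 0).
  by move=> i; rewrite subrr.
rewrite -(b_uniq r); first by apply: b_uniq => i; rewrite subrr.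
by move=> i; rewrite subr0.
Qed.

(** The digit at g being 0, no carry arises; the induction strips the first digit. *)
Lemma digit_update r g c j : digit r g = 0 ->
  digit (r + tau c * t ^+ g) j = if j == g then c else digit r j.
Proof.
elim: g r j => [|g IHg] r j r0.
  have rE : r + tau c * t ^+ 0 = tau c + digit_rest r * t.
    rewrite {1}[r]digit_restE; move: r0; rewrite /digit /= => ->.
    by rewrite section0 add0r mulr1 addrC.
  rewrite rE; case: j => [|j]; first exact: residueDM.
  by rewrite !digitS digit_restDM.
have rE : r + tau c * t ^+ g.+1 =
    tau (pi r) + (digit_rest r + tau c * t ^+ g) * t.
  by rewrite {1}[r]digit_restE mulrDl -mulrA -exprSr addrA.
rewrite rE; case: j => [|j]; first exact: residueDM.
by rewrite !digitS digit_restDM IHg // -digitS.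
Qed.

Lemma digit_surj c : exists r, forall j, digit r j = c j.
Proof.
pose u i := \sum_(j < i) tau (c j) * t ^+ j.
have uE i j : digit (u i) j = if (j < i)%N then c j else 0.
  elim: i j => [|i IHi] j; first by rewrite /u big_ord0 digit0.
  rewrite /u big_ord_recr /= digit_update ?IHi ?ltnn // ltnS.
  by case: ltngtP => // ->.
have [|r [rP _]] := dvr_complete Advr (u := u).
  move=> i; apply/digit_agree => j ltji; rewrite !uE ltji.
  by rewrite ltnS ltnW.
by exists r => j; have /digit_agree-> // := rP j.+1; rewrite uE ltnSn.
Qed.

Lemma seq1P (a : seq nat) : size a = 1%N -> a = [:: nth 0%N a 0].
Proof. by case: a => [|j []]. Qed.

Lemma dvr_good : good_coefs tau [:: t] (fun r a => digit r (nth 0%N a 0)).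
Proof.
(* In one variable the exponents outside V form an initial segment, so agreement off V amounts to
   congruences on r - s. Both sides of [cf_agree] are translated into these same congruences. *)
have digit_agreeV V : upclosed 1 V -> forall r s,
    (forall a, size a = 1%N -> ~ V a -> digit r (nth 0%N a 0) = digit s (nth 0%N a 0)) <->
    (forall a, size a = 1%N -> ~ V a -> max_ideal_pow A (nth 0%N a 0).+1 (r - s)).
  move=> upV r s; split=> rs a sz_a Va; last by have /digit_agree-> := rs a sz_a Va.
  apply/digit_agree => j; rewrite ltnS => leja.
  apply: (rs [:: j]) => // Vj; apply: Va; apply: upV Vj => //.
  by case=> [|i] //=; rewrite nth_nil.
split; first split=> /=.
- by move=> r r0; apply: digit_eq0 => j; apply: (r0 [:: j]).
- move=> c; have [r rP] := digit_surj (fun j => c [:: j]).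
  by exists r => a sz_a; rewrite rP -seq1P.
- move=> V upV r s.
  have := digit_agreeV _ upV (r - s) 0; rewrite subr0 => -[to_pow of_pow].
  split=> rs.
    apply/(digit_agreeV _ upV)/to_pow => a sz_a Va.
    by rewrite digit0 rs.
  move=> a sz_a Va; rewrite -(digit0 (nth 0%N a 0)).
  by apply: of_pow a sz_a Va; apply/(digit_agreeV _ upV).
- move=> r g c sz_g r0 a sz_a; rewrite /seq_mon big_ord1 /= digit_update //.
  by case: a g sz_a sz_g {r0} => [|i []] // [|j []] // _ _; rewrite eqseq_cons andbT.
move=> N r; rewrite -[r in max_ideal_pow _ _ r]subr0 digit_agree; split=> r0.
  move=> a /= sz_a; rewrite [a]seq1P //= addn0 => /r0->; exact: digit0.
by move=> j ltjN; rewrite digit0; apply: (r0 [:: j]); rewrite //= addn0.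
Qed.

End DVRBase.

Lemma iterated_local_sps_good (p : nat) (k : finFieldType) (R : unitRingType)
    (iota : k -> R) (xs : seq R) : iterated_local_sps p iota xs ->
  [/\ {morph iota : a b / a * b}, iota 0 = 0 &
    forall c r, iota c * r = r * iota c] /\
  local_ring R /\ exists cf, good_coefs iota xs cf.
Proof.
case=> {iota xs} [f xs _ iterP|A pi tau t f xs Advr _ _ _ piP tP tauM tauK iterP].
  have kgood : exists cf, good_coefs (id : k -> k) [::] cf.
    by exists (fun r _ => r); apply: field_good.
  have [Rloc fC [cf cfP]] := iterated_sps_good (@field_local k) (@mulrC k) kgood iterP.
  split; last by split=> //; exists cf.
  have [g fE] := iterated_sps_rmorph iterP.
  split=> [a b||c r]; last exact: fC.
  - by rewrite fE rmorphM.
  - by rewrite fE rmorph0.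
have Agood : exists cf, good_coefs tau [:: t] cf.
  by exists (fun r a => digit piP tP tauK r (nth 0%N a 0)); apply: dvr_good.
have [Rloc fC [cf cfP]] := iterated_sps_good (dvr_local Advr) (@mulrC A) Agood iterP.
split; last by split=> //; exists cf.
have [g fE] := iterated_sps_rmorph iterP.
split=> [a b||c r] /=; last exact: fC.
- by rewrite tauM fE rmorphM.
- by rewrite (section0 tauM tauK) fE rmorph0.
Qed.

(** * Exponents and coordinates indexed by N^n *)

(** Dickson's lemma for objects carrying n numerical values, so that it selects elements of an ideal
    directly rather than their leading monomials. *)
Lemma dickson (T : choiceType) (n : nat) (f : nat -> T -> nat) (S : set T) :
  exists L : seq T, (forall t, t \in L -> S t) /\
    forall t, S t -> exists2 u, u \in L & forall i, (i < n)%N -> (f i u <= f i t)%N.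
Proof.
elim: n S => [|n IHn] S.
  have [[t St]|S0] := pselect (exists t, S t).
    by exists [:: t]; split=> [u /[!inE]/eqP->//|u _]; exists t; rewrite ?inE.
  by exists [::]; split=> // t St; case: S0; exists t.
have [L [LS LP]] := IHn S.
have [K KP] := choice (fun j => IHn (S `&` [set t | f n t = j])).
(* Elements whose last value is at least M are dominated by L in all coordinates; each of the
   finitely many levels j < M has its own list [K j]. *)
pose M := \max_(t <- L) f n t.
exists (L ++ flatten [seq K j | j <- iota 0 M]); split=> [t|t St].
  rewrite mem_cat => /orP[/LS//|/flatten_mapP[j _]].
  by have [KS _] := KP j => /KS[].
have [leMt|lttM] := leqP M (f n t).
  have [u Lu le_ut] := LP t St; exists u; first by rewrite mem_cat Lu.
  move=> i; rewrite ltnS leq_eqVlt => /orP[/eqP->|]; last exact: le_ut.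
  by apply: leq_trans leMt; apply: (@leq_bigmax_seq _ L xpredT (f n)).
have [_ /(_ t)[//|u Ku le_ut]] := KP (f n t).
exists u.
  rewrite mem_cat; apply/orP; right; apply/flatten_mapP.
  by exists (f n t); rewrite // mem_iota.
move=> i; rewrite ltnS leq_eqVlt => /orP[/eqP->|]; last exact: le_ut.
by have [KS _] := KP (f n t); have [_ /= ->] := KS _ Ku.
Qed.

Section Exponents.
Variable n : nat.
Implicit Types a b g : 'N^n.

Definition exp_seq a : seq nat := [seq a i | i <- enum 'I_n].
Definition exp_of_seq (s : seq nat) : 'N^n := [ffun i : 'I_n => nth 0%N s i].

Lemma size_exp_seq a : size (exp_seq a) = n.
Proof. by rewrite size_map size_enum_ord. Qed.

Lemma nth_exp_seq a (i : 'I_n) : nth 0%N (exp_seq a) i = a i.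
Proof. by rewrite (nth_map i) ?size_enum_ord // nth_ord_enum. Qed.

Lemma exp_seqK : cancel exp_seq exp_of_seq.
Proof. by move=> a; apply/ffunP => i; rewrite ffunE nth_exp_seq. Qed.

Lemma exp_of_seqK s : size s = n -> exp_seq (exp_of_seq s) = s.
Proof.
move=> sz_s; apply: (@eq_from_nth _ 0%N); rewrite size_exp_seq // => i ltin.
by rewrite (nth_exp_seq _ (Ordinal ltin)) ffunE.
Qed.

Definition exp_deg a : nat := sumn (exp_seq a).

Lemma exp_deg_ge a i : (a i <= exp_deg a)%N.
Proof.
rewrite /exp_deg sumnE big_map big_enum /=.
by rewrite (bigD1 i) //= leq_addr.
Qed.

Lemma exp_subK a b : (forall i, a i <= b i)%N -> exists g, b = a + g.
Proof.
move=> le_ab; exists [ffun i => (b i - a i)%N].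
by apply/ffunP => i; rewrite !ffunE; apply/esym/subnKC.
Qed.

Definition small_exps N : seq 'N^n :=
  [seq [ffun i => val (h i)] | h : {ffun 'I_n -> 'I_N}].

Lemma small_expsP N a : (exp_deg a < N)%N -> a \in small_exps N.
Proof.
move=> ltaN; have lt_a i : (a i < N)%N by apply: leq_ltn_trans ltaN; apply: exp_deg_ge.
apply/fintype.imageP; exists [ffun i => Ordinal (lt_a i)] => //.
by apply/ffunP => i; rewrite !ffunE.
Qed.

Definition exp_ideal (V : set 'N^n) : Prop := forall a b, V a -> V (a + b).

Lemma exp_ideal_upclosed V : exp_ideal V -> upclosed n [set s | V (exp_of_seq s)].
Proof.
move=> idV s s' sz_s sz_s' le_s /= Vs.
have [|g ->] := @exp_subK (exp_of_seq s) (exp_of_seq s'); last exact: idV.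
by move=> i; rewrite !ffunE.
Qed.

End Exponents.

(** * Coefficients and supports of elements of R *)

Section Coefficients.
Variables (k : finFieldType) (R : unitRingType) (n : nat) (iota : k -> R).
Variables (x : n.-tuple R) (cf : R -> seq nat -> k).
Hypothesis cf_good : good_coefs iota x cf.
Implicit Types (r s : R) (a b g : 'N^n) (V W : set 'N^n).

Let cfP : coef_system iota x cf := proj1 cf_good.

Let size_exp_var a : size (exp_seq a) = size x.
Proof. by rewrite size_exp_seq size_tuple. Qed.

Hint Resolve size_exp_var : core.

Definition mcoef r a : k := cf r (exp_seq a).

Lemma mcoef_inj r s : mcoef r =1 mcoef s -> r = s.
Proof.
move=> eq_rs; apply: (cf_subr_eq0 cfP) => a; rewrite size_tuple => sz_a.
by rewrite -(exp_of_seqK sz_a); apply: eq_rs.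
Qed.

Lemma mcoef0 a : mcoef 0 a = 0.
Proof. exact: (cf0 cfP). Qed.

Lemma mcoef_surj (c : 'N^n -> k) : exists r, mcoef r =1 c.
Proof.
have [r rP] := cf_surj cfP (c \o @exp_of_seq n); exists r => a.
by rewrite /mcoef rP //= exp_seqK.
Qed.

Lemma seq_mon_exp a : seq_mon x (exp_seq a) = monomial x a.
Proof.
rewrite /seq_mon /monomial size_tuple; apply: eq_bigr => i _.
by rewrite nth_exp_seq (tnth_nth 0).
Qed.

Lemma mcoef_update r g c a : mcoef r g = 0 ->
  mcoef (r + iota c * monomial x g) a = if a == g then c else mcoef r a.
Proof.
move=> r0; rewrite /mcoef -seq_mon_exp (cf_update cfP) //.
by rewrite (can_eq (@exp_seqK n)).
Qed.

Lemma mcoef_term g c a : mcoef (iota c * monomial x g) a = if a == g then c else 0.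
Proof.
by rewrite -[X in mcoef X]add0r mcoef_update mcoef0.
Qed.

Definition supp_in V r : Prop := forall a, ~ V a -> mcoef r a = 0.

Lemma supp_in_agree V r s : exp_ideal V ->
  supp_in V (r - s) <-> forall a, ~ V a -> mcoef r a = mcoef s a.
Proof.
move=> /exp_ideal_upclosed; rewrite -{1}(size_tuple x) => upV.
have [H1 H2] := cf_agree cfP upV r s; rewrite size_tuple in H1 H2.
split=> rs a Va.
  apply: H1; rewrite ?size_exp_seq //=; last by rewrite exp_seqK.
  by move=> b sz_b Vb; rewrite -(exp_of_seqK sz_b); apply: rs.
apply: H2; rewrite ?size_exp_seq //=; last by rewrite exp_seqK.
by move=> b sz_b Vb; rewrite -(exp_of_seqK sz_b); apply: rs.
Qed.

Lemma pow_agree N r s : max_ideal_pow R N (r - s) <->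
  forall a, (exp_deg a < N)%N -> mcoef r a = mcoef s a.
Proof.
rewrite (proj2 cf_good) (ord_ge_agree cfP) size_tuple.
split=> rs a; first by move=> lta; apply: rs; rewrite ?size_exp_seq.
move=> sz_a lta; rewrite -(exp_of_seqK sz_a); apply: rs.
by rewrite /exp_deg exp_of_seqK.
Qed.

(** As F has no repetition, each term is added at an exponent where the sum so far has coordinate 0,
    hence without carries. *)
Lemma mcoef_sum (c : 'N^n -> k) (F : seq 'N^n) a : uniq F ->
  mcoef (\sum_(b <- F) iota (c b) * monomial x b) a = if a \in F then c a else 0.
Proof.
elim: F a => [|b F IHF] a /=; first by rewrite big_nil mcoef0.
move=> /andP[notFb uniqF]; rewrite big_cons addrC mcoef_update; last first.
  by rewrite IHF // (negPf notFb).
by rewrite IHF // inE; case: eqP => // ->.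
Qed.

Lemma expansion_mcoef r : expansion iota x r (mcoef r).
Proof.
move=> N; exists (small_exps n N) => F uniqF sub_F.
by apply/pow_agree => a lta; rewrite mcoef_sum // sub_F ?small_expsP.
Qed.

Lemma expansion_unique r c : expansion iota x r c -> c = mcoef r.
Proof.
move=> rc; have [s sc] := mcoef_surj c.
suff -> : r = s by apply/funext => a; rewrite sc.
apply: mcoef_inj => a.
have [F0 F0P] := rc (exp_deg a).+1.
(* Containing F0 makes the finite sum close to r; containing the small exponents makes it have
   coordinate [c a] at a. *)
pose F := undup (F0 ++ small_exps n (exp_deg a).+1).
have sub_F : {subset F0 <= F} by move=> b F0b; rewrite mem_undup mem_cat F0b.
have /pow_agree/(_ a (ltnSn _)) -> := F0P F (undup_uniq _) sub_F.
rewrite mcoef_sum ?undup_uniq //.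
by rewrite mem_undup mem_cat small_expsP // orbT sc.
Qed.

Lemma coeffsE r : coeffs iota x r = mcoef r.
Proof.
apply: expansion_unique.
exact: (@xgetI _ _ [set a | expansion iota x r a] _ (expansion_mcoef r)).
Qed.

Lemma supp_in0 V : supp_in V 0.
Proof. by move=> a _; apply: mcoef0. Qed.

Lemma supp_inB V r s : exp_ideal V -> supp_in V r -> supp_in V s -> supp_in V (r - s).
Proof. by move=> idV r0 s0; apply/supp_in_agree => // a Va; rewrite r0 ?s0. Qed.

Lemma supp_inD V r s : exp_ideal V -> supp_in V r -> supp_in V s -> supp_in V (r + s).
Proof.
move=> idV r0 s0; rewrite -(opprK s); apply: supp_inB => //; rewrite -sub0r.
by apply: supp_inB => //; apply: supp_in0.
Qed.

Lemma supp_in_sum V (T : Type) (l : seq T) (P : pred T) (u : T -> R) :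
  exp_ideal V -> (forall i, P i -> supp_in V (u i)) ->
  supp_in V (\sum_(i <- l | P i) u i).
Proof.
by move=> idV u0; elim/big_ind: _ => // [|r s]; [apply: supp_in0|apply: supp_inD].
Qed.

Lemma supp_in_closed V r :
  (forall N, exists2 s, supp_in V s & max_ideal_pow R N (r - s)) -> supp_in V r.
Proof.
move=> r_lim a Va; have [s s0 /pow_agree rs] := r_lim (exp_deg a).+1.
by rewrite rs ?ltnSn ?s0.
Qed.

Lemma supp_in_term V g c : V g -> supp_in V (iota c * monomial x g).
Proof. by move=> Vg a Va; rewrite mcoef_term; case: eqP => // eq_ag; case: Va; rewrite eq_ag. Qed.

(** Terms at exponents outside V vanish since [iota 0 = 0], so r is a limit of finite sums of terms
    in V. *)
Lemma supp_in_approx V r N : supp_in V r -> iota 0 = 0 ->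
  exists F : seq 'N^n, max_ideal_pow R N
    (r - \sum_(a <- F | `[< V a >]) iota (mcoef r a) * monomial x a).
Proof.
move=> r0 iota0; have [F FP] := expansion_mcoef r N; exists (undup F).
rewrite big_mkcond (eq_bigr (fun a => iota (mcoef r a) * monomial x a)).
  by apply: FP; [apply: undup_uniq|move=> a; rewrite mem_undup].
by move=> a _; case: asboolP => // /r0->; rewrite iota0 mul0r.
Qed.

End Coefficients.

(** * Monomial orders *)

Section AdditiveOrder.
Variables (n : nat) (le : rel 'N^n).
Hypothesis leP : additive_total_order le.
Implicit Types (a b g : 'N^n) (V : set 'N^n).

Lemma ato_refl a : le a a.
Proof. by have := ato_total leP a a; rewrite orbb. Qed.

Lemma ato_addr a b : le a (a + b).
Proof.
have [->|b0] := eqVneq b 0; first by rewrite addr0 ato_refl.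
have [_] := ato_add leP a (contra_neq esym b0) (ato_pos leP b0).
by rewrite add0r addrC.
Qed.

Definition up_ge g : set 'N^n := [set a | le g a].
Definition up_gt g : set 'N^n := [set a | le g a /\ a != g].

Lemma exp_ideal_ge g : exp_ideal (up_ge g).
Proof. by move=> a b /= le_ga; apply: ato_trans leP _ _ _ le_ga (ato_addr a b). Qed.

Lemma exp_ideal_gt g : exp_ideal (up_gt g).
Proof.
move=> a b [le_ga ne_ag]; split; first exact: exp_ideal_ge.
apply: contra_neq ne_ag => abg; apply: (ato_anti leP).
by rewrite le_ga -{1}abg ato_addr.
Qed.

(** Dickson's lemma gives a finite part of S lying componentwise, hence also for [le], below all of
    S; its minimum is that of S. *)
Lemma ato_min (S : set 'N^n) : S !=set0 -> exists2 a, S a & forall b, S b -> le a b.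
Proof.
move=> [s Ss].
have [L [LS LP]] := @dickson _ n (fun i a => nth 0%N (exp_seq a) i) S.
have geL t : S t -> exists2 u, u \in L & le u t.
  move=> /LP[u Lu le_ut]; exists u => //.
  have [|g ->] := @exp_subK _ u t; last exact: ato_addr.
  by move=> i; rewrite -!nth_exp_seq le_ut.
have minL : exists2 a, a \in L & forall b, b \in L -> le a b.
  have [u + _] := geL s Ss; elim: (L) u => // v K IHK _ _.
  case: K IHK => [_|w K /(_ w (mem_head _ _))[a Ka leKa]].
    by exists v; rewrite ?mem_head // => b /[!inE]/eqP->; apply: ato_refl.
  have [le_va|le_av] := orP (ato_total leP v a).
    exists v; first exact: mem_head.
    move=> b /[!inE] /orP[/eqP->|/leKa]; first exact: ato_refl.
    exact: ato_trans leP _ _ _ le_va.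
  exists a; first by rewrite inE Ka orbT.
  by move=> b; rewrite inE => /orP[/eqP->|/leKa].
have [a La leL] := minL; exists a; first exact: LS.
by move=> b /geL[u /leL le_au]; apply: ato_trans leP _ _ _ le_au.
Qed.

End AdditiveOrder.

(** Otherwise the complements of all the fibres would lie in F, and so would their finite
    intersection, which is empty. *)
Lemma ultra_fin (T : Type) (K : finType) (F : set_system T) (f : T -> K) :
  UltraFilter F -> exists c, F [set t | f t = c].
Proof.
move=> Fultra; apply: contrapT => /forallNP noc.
have FC c : F (~` [set t | f t = c]).
  by have [/(noc c)|] := in_ultra_setVsetC [set t | f t = c] Fultra.
have Fproper := @ultra_proper _ _ Fultra.
by have [t /(_ (f t))] := filter_ex (filter_forall _ FC); apply.
Qed.

(** * Leading monomials, reduction and compactness *)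

Section LeadingMonomials.
Variables (k : finFieldType) (R : unitRingType) (n : nat) (iota : k -> R).
Variables (x : n.-tuple R) (cf : R -> seq nat -> k) (le : rel 'N^n).
Hypothesis cf_good : good_coefs iota x cf.
Hypothesis iotaM : {morph iota : a b / a * b}.
Hypothesis iota0 : iota 0 = 0.
Hypothesis iotaC : forall c r, iota c * r = r * iota c.
Hypothesis le_mon : monomial_order iota x le.
Implicit Types (r s h : R) (a b g : 'N^n) (V W : set 'N^n) (c : k).

Let leP : additive_total_order le := proj1 le_mon.
Local Notation mcf := (mcoef cf).
Local Notation LMx := (LM iota x le).
Local Notation mon := (monomial x).

Lemma LM_spec r : r != 0 ->
  mcf r (LMx r) != 0 /\ supp_in cf (up_ge le (LMx r)) r.
Proof.
move=> r0; have [|a ra a_min] := ato_min leP (S := [set a | mcf r a != 0]).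
  apply/not_existsP => no_supp; case/eqP: r0; apply: (mcoef_inj cf_good) => a.
  by rewrite (mcoef0 cf_good); apply/eqP/negPn/negP => /(no_supp a).
have [] : [set a | supp iota x r a /\ forall b, supp iota x r b -> le a b] (LMx r).
  apply: xgetI (a) _; rewrite /supp /= (coeffsE cf_good); split=> //.
rewrite /supp /= (coeffsE cf_good) => rLM LM_min; split=> // b nle.
by apply/eqP/negPn/negP => /LM_min.
Qed.

Lemma LM_nonzero_in g r : r != 0 -> supp_in cf (up_ge le g) r -> le g (LMx r).
Proof.
move=> /LM_spec[rLM _] rg; apply/negPn/negP => nle; case/eqP: rLM.
by apply: rg => /= le_g; rewrite le_g in nle.
Qed.

(** Outside [up_gt le g], r and its term at g have the same coordinates: equal at g, and 0
    elsewhere. [supp_in_agree] passes to the difference. *)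
Lemma supp_in_lead g r : supp_in cf (up_ge le g) r ->
  supp_in cf (up_gt le g) (r - iota (mcf r g) * mon g).
Proof.
move=> rg; apply/(supp_in_agree cf_good); first exact: exp_ideal_gt.
move=> a nlt_ga; rewrite (mcoef_term cf_good).
case: eqP => [->//|ne_ag]; apply: rg => /= le_ga; apply: nlt_ga.
by split=> //; apply/eqP.
Qed.

(** Left multiplication by s is continuous, so a support bound for s * r need only be checked on
    single terms. *)
Let supp_in_lim V W s r : exp_ideal W -> (forall N u, max_ideal_pow R N u ->
    max_ideal_pow R N (s * u)) ->
  (forall a c, V a -> supp_in cf W (s * (iota c * mon a))) ->
  supp_in cf V r -> supp_in cf W (s * r).
Proof.
move=> idW sMl sW rV; apply: (supp_in_closed cf_good) => N.
have [F FP] := supp_in_approx cf_good N rV iota0.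
exists (s * \sum_(a <- F | `[< V a >]) iota (mcf r a) * mon a).
  rewrite mulr_sumr; apply: (supp_in_sum cf_good) => // a /asboolP; exact: sW.
by rewrite -mulrBr; apply: sMl.
Qed.

Hypothesis Rlocal : local_ring R.

Lemma supp_in_scale V c r : exp_ideal V -> supp_in cf V r -> supp_in cf V (iota c * r).
Proof.
move=> idV; apply: supp_in_lim => // [N u|a d Va]; first exact: max_ideal_powMl.
by rewrite mulrA -iotaM; apply: (supp_in_term cf_good).
Qed.

Lemma monomial0 : mon 0 = 1.
Proof. by rewrite /monomial big1 // => i _; rewrite ffunE. Qed.

(** On 0 the function [LM] takes its default value 0. A zero product would thus give a + b = 0,
    hence a = b = 0, and the product would be 1. *)
Lemma monomialM_neq0 a b : mon a * mon b != 0.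
Proof.
apply/eqP => ab0; have := proj2 le_mon a b; rewrite ab0.
rewrite /LM xgetPN => [/esym/ffunP ab_eq0|g [/eqP]]; last first.
  by rewrite (coeffsE cf_good) (mcoef0 cf_good).
have zero (u v : 'N^n) : (forall i, (u + v) i = (0 : 'N^n) i) -> u = 0.
  by move=> uv0; apply/ffunP => i; have /eqP := uv0 i; rewrite !ffunE addn_eq0 => /andP[/eqP].
have a0 := zero a b ab_eq0; have b0 : b = 0.
  by apply: (zero b a) => i; rewrite addrC ab_eq0.
by move/eqP: ab0; rewrite a0 b0 monomial0 mulr1 oner_eq0.
Qed.

Lemma supp_in_monomialM a b : supp_in cf (up_ge le (a + b)) (mon a * mon b).
Proof. by have [_] := LM_spec (monomialM_neq0 a b); rewrite (proj2 le_mon). Qed.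

Lemma mcoef_monomialM a b : mcf (mon a * mon b) (a + b) != 0.
Proof. by have [+ _] := LM_spec (monomialM_neq0 a b); rewrite (proj2 le_mon). Qed.

Lemma supp_in_monM b g r : supp_in cf (up_gt le g) r ->
  supp_in cf (up_gt le (b + g)) (mon b * r).
Proof.
apply: supp_in_lim => [|N u|a c [le_ga ne_ag]]; first exact: exp_ideal_gt.
  exact: max_ideal_powMl.
rewrite mulrA -iotaC -mulrA; apply: supp_in_scale; first exact: exp_ideal_gt.
have [ne_gab le_gab] := ato_add leP b (contra_neq esym ne_ag) le_ga.
move=> d ngt_d; apply: (supp_in_monomialM (a := b) (b := a)) => /= le_d; apply: ngt_d.
rewrite ![b + _]addrC in le_d *.
split; first exact: ato_trans leP _ _ _ le_gab le_d.
apply: contra_neq ne_gab => dE; apply: (ato_anti leP).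
by rewrite le_gab -dE.
Qed.

(** Modulo exponents above g, h is [iota c * mon g] and [mon b * r] is [iota (d * e) * mon g], where
    d is the leading coefficient of r and e that of [mon b * mon a]. The factor d can be moved past
    [mon b] because [iota d] is central. *)
Lemma reduction h r b : h != 0 -> r != 0 -> LMx h = b + LMx r ->
  exists c, supp_in cf (up_gt le (LMx h)) (h - iota c * (mon b * r)).
Proof.
move=> h0 r0 LMh; have [_ /supp_in_lead h_lead] := LM_spec h0.
have [rLM /supp_in_lead r_lead] := LM_spec r0.
set g := LMx h in LMh h_lead *; set a := LMx r in LMh rLM r_lead.
set c := mcf h g in h_lead; set d := mcf r a in rLM r_lead.
have := mcoef_monomialM b a; have := supp_in_lead (supp_in_monomialM (a := b) (b := a)).
rewrite -LMh; set e := mcf _ g => ba_lead e0.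
have idV : exp_ideal (up_gt le g) := exp_ideal_gt leP (g := g).
have br_lead : supp_in cf (up_gt le g) (mon b * r - iota (d * e) * mon g).
  have -> : mon b * r - iota (d * e) * mon g =
    mon b * (r - iota d * mon a) + iota d * (mon b * mon a - iota e * mon g).
    by rewrite !mulrBr iotaM !mulrA -(iotaC d (mon b)) addrA subrK.
  apply: (supp_inD cf_good) => //; last exact: supp_in_scale.
  by rewrite LMh; apply: supp_in_monM.
(* This scalar makes the two leading terms equal, by multiplicativity of [iota] alone. *)
exists (c / (d * e)).
have -> : h - iota (c / (d * e)) * (mon b * r) =
    (h - iota c * mon g) - iota (c / (d * e)) * (mon b * r - iota (d * e) * mon g).
  rewrite [in RHS]mulrBr [iota _ * (iota _ * _)]mulrA -iotaM divfK ?mulf_neq0 //.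
  by rewrite opprB addrA subrK.
by apply: (supp_inB cf_good) => //; apply: supp_in_scale.
Qed.

(* [k] is finite, so [R], identified with a power of [k], is compact. *)
Lemma chain_compact (T : Type) (m : nat) (D : set T) (C : T -> set ('I_m -> R)) :
  D !=set0 -> (forall i, D i -> C i !=set0) ->
  (forall i j, D i -> D j -> C i `<=` C j \/ C j `<=` C i) ->
  exists q, forall i N, D i ->
    exists2 q', C i q' & forall l, max_ideal_pow R N (q l - q' l).
Proof.
move=> D0 C0 C_chain.
have CF : ProperFilter (filter_from D C).
  apply: filter_from_proper => //; apply: filter_from_filter => // i j Di Dj.
  have [Cij|Cji] := C_chain i j Di Dj.
    by exists i => // q Ciq; split; last exact: Cij.
  by exists j => // q Cjq; split; first exact: Cji.
(* The [C i] form a filter base since they are a chain; an ultrafilter above it stands in for a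
   convergent subnet. *)
have [G [Gultra CG]] := ultraFilterLemma CF.
have Gproper := @ultra_proper _ _ Gultra.
(* Along G each coordinate takes one value of k on a large set; these values are the coordinates of
   the limit q. *)
have [q qP] : exists q, forall l a, G [set q' | mcf (q l) a = mcf (q' l) a].
  have [c cP] := choice (fun la : 'I_m * 'N^n =>
    ultra_fin (fun q : 'I_m -> R => mcf (q la.1) la.2) Gultra).
  have [q qP] := choice (fun l => mcoef_surj cf_good (fun a => c (l, a))).
  by exists q => l a; rewrite qP; apply: filterS (cP (l, a)) => q' /= ->.
exists q => i N Di.
(* Only finitely many exponents lie in this box, so one large set of q' agrees with q on all of
   them, which controls the difference modulo the N-th power. *)
pose small (u : {ffun 'I_n -> 'I_N}) : 'N^n := [ffun j => val (u j)].
have Gsmall : G [set q' | forall (l : 'I_m) (u : {ffun 'I_n -> 'I_N}),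
    mcf (q l) (small u) = mcf (q' l) (small u)].
  by apply: filter_forall => l; apply: filter_forall => u; apply: qP.
have GC : G (C i) by apply: CG; exists i.
have [q' [Cq' q'_small]] := filter_ex (filterI GC Gsmall).
exists q' => // l; apply/(pow_agree cf_good) => a /small_expsP/fintype.imageP[u _ ->].
exact: q'_small.
Qed.

Lemma left_ideal_sum (I : set R) m (q u : 'I_m -> R) : left_ideal I ->
  (forall l, I (u l)) -> I (\sum_l q l * u l).
Proof.
move=> [I0 ID IM] Iu; elim/big_ind: _ => // l _; exact: IM.
Qed.

Lemma left_idealB (I : set R) r s : left_ideal I -> I r -> I s -> I (r - s).
Proof. by move=> [_ ID IM] Ir Is; apply: ID => //; rewrite -mulN1r; apply: IM. Qed.

Lemma LM_eq_ideal (I J : set R) : left_ideal I -> left_ideal J -> I `<=` J ->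
  LM_set iota x le I = LM_set iota x le J -> J `<=` I.
Proof.
move=> idI idJ IJ LMIJ f Jf; apply: contrapT => notIf.
(* L is a finite list in I whose leading monomials generate [LM_set] of I as a monomial ideal. *)
have [L [LI LP]] := @dickson _ n (fun i r => nth 0%N (exp_seq (LMx r)) i)
  [set r | I r /\ r != 0].
pose u (l : 'I_(size L)) := L`_l.
have uP l : I (u l) /\ u l != 0 by apply: LI; apply: mem_nth.
have Iu l : I (u l) by have [] := uP l.
pose C g : set ('I_(size L) -> R) :=
  [set q | supp_in cf (up_ge le g) (f - \sum_l q l * u l)].
have C_anti g g' : le g g' -> C g' `<=` C g.
  move=> le_g q qC a nle; apply: qC => /= le_g'; apply: nle.
  exact: ato_trans leP _ _ _ le_g le_g'.
have [q qP] : exists q, forall g, C g !=set0 -> C g q.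
  have [|//|g g' _ _|q qP] := @chain_compact _ _ [set g | C g !=set0] C.
  (* Every exponent is at least 0, so [C 0] contains every q and the chain is nonempty. *)
  - exists 0, (fun=> 0) => a []; have [->|a0] := eqVneq a 0; first exact: ato_refl.
    exact: ato_pos.
  - by case/orP: (ato_total leP g g') => /C_anti; [right|left].
  exists q => g Cg; apply: (supp_in_closed cf_good) => N.
  have [q' Cq' qq'] := qP g N Cg; exists (f - \sum_l q' l * u l) => //.
  have -> : f - \sum_l q l * u l - (f - \sum_l q' l * u l) =
      \sum_l -1 * (q l - q' l) * u l.
    under [RHS]eq_bigr do rewrite mulN1r opprB mulrBl.
    by rewrite sumrB opprB addrC addrA subrK.
  by apply: max_ideal_pow_sum => l _; apply/max_ideal_powMr/max_ideal_powMl.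
pose h := f - \sum_l q l * u l.
(* Since h differs from f by an element of I and f is not in I, subtracting elements of I from h
   never gives 0; this applies to h and to h'. *)
have notIh r : I r -> h - r != 0.
  move=> Ir; apply/eqP => /subr0_eq hr; apply: notIf.
  rewrite -[f](subrK (\sum_l q l * u l)) -/h hr.
  by have [_ ID _] := idI; apply: ID => //; apply: left_ideal_sum.
have h0 : h != 0 by rewrite -(subr0 h); apply: notIh; case: idI.
have Jh : J h.
  by apply: left_idealB => //; apply: left_ideal_sum => // l; apply: IJ.
have [h1 [Ih1 h10] LMh] : LM_set iota x le I (LMx h) by rewrite LMIJ; exists h.
have [v Lv le_v] := LP h1 (conj Ih1 h10).
have [Iv v0] := LI v Lv.
have [|b LMhE] := @exp_subK _ (LMx v) (LMx h1).
  by move=> i; rewrite -!nth_exp_seq; apply: le_v.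
have [c] : exists c, supp_in cf (up_gt le (LMx h)) (h - iota c * (mon b * v)).
  by apply: reduction => //; rewrite -LMh LMhE addrC.
set h' := h - _ => h'_gt.
have h'0 : h' != 0 by have [_ _ IM] := idI; apply: notIh; apply: (IM); apply: (IM).
have [h'LM h'_ge] := LM_spec h'0.
have [le_h_h' ne_h_h'] : up_gt le (LMx h) (LMx h').
  by apply: contrapT => /h'_gt/eqP; apply/negP.
have lt_v : (index v L < size L)%N by rewrite index_mem.
have Cq : C (LMx h') q.
  (* Adding the reduction multiplier to the coefficient of v turns h into h', so [C (LMx h')] is
     nonempty and therefore contains q. Then h is supported above [LMx h'], against [LMx h] being
     strictly smaller. *)
  apply: qP; exists (fun l => q l + (if l == Ordinal lt_v then iota c * mon b else 0)).
  rewrite /C /=; set S := \sum_l _.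
  suff -> : f - S = h' by [].
  rewrite /h' /h /S; under eq_bigr do rewrite mulrDl.
  rewrite big_split opprD addrA; congr (_ - _).
  rewrite (bigD1 (Ordinal lt_v)) //= eqxx big1 ?addr0 => [|l /negPf->]; last exact: mul0r.
  by rewrite /u /= nth_index // mulrA.
case/eqP: ne_h_h'; apply: (ato_anti leP).
by rewrite le_h_h' andbT; apply: LM_nonzero_in.
Qed.

End LeadingMonomials.

Theorem corollary5p5 (p n : nat) (k : finFieldType) (R : unitRingType)
    (iota : k -> R) (x : n.-tuple R) (le : rel 'N^n) (I J : set R) :
  iterated_local_sps p iota x ->
  monomial_order iota x le ->
  left_ideal I -> left_ideal J ->
  I `<=` J -> LM_set iota x le I = LM_set iota x le J ->
  I = J.
Proof.
move=> /iterated_local_sps_good[[iotaM iota0 iotaC] [Rloc [cf cf_good]]].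
move=> le_mon idI idJ IJ LMIJ; apply/seteqP; split=> //.
exact: (LM_eq_ideal cf_good iotaM iota0 iotaC le_mon Rloc idI idJ IJ LMIJ).
Qed.
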